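(* Solutions $\psi$ of $$\psi_{z\bar z}+\tfrac12e^{\psi}+|U|^2e^{-2\psi}=0\qquad\text{with } U=z^{-2}$$ that are invariant under the group of rotations $z\to e^{ic}z$, $c\in\mathbb{R}$, are of the form $$\psi(z,\bar z)=\log H(s)-3\log(s),\qquad s=|z|^{1/2},$$ where $H$ satisfies $$H_{ss}=\frac{(H_s)^2}{H}-\frac{H_s}{s}-\frac{8H^2}{s}-\frac{16}{H},$$ which is the Painlevé III equation with parameters $(-8,0,0,-16)$.
   Context: $\psi$ is a real valued function of $(z,\bar z)$ on an open (rotation invariant) subset of $\mathbb{C}\setminus\{0\}$; subscripts denote derivatives. The Painlevé III equation with parameters $(\alpha,\beta,\gamma,\delta)$ is $$H_{ss}=\frac{(H_s)^2}{H}-\frac{H_s}{s}+\frac{\alpha H^2+\beta}{s}+\gamma H^3+\frac{\delta}{H}.$$ *)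

(* Defs.v *)
From Stdlib Require Import Reals.
From Coquelicot Require Import Coquelicot.
Open Scope R_scope.

Definition partial_x (f : C -> C) (z : C) : C :=
  (Derive (fun t => Re (f (t, Im z))) (Re z),
   Derive (fun t => Im (f (t, Im z))) (Re z)).

Definition partial_y (f : C -> C) (z : C) : C :=
  (Derive (fun t => Re (f (Re z, t))) (Im z),
   Derive (fun t => Im (f (Re z, t))) (Im z)).

(* Wirtinger derivatives *)
Definition D_z (f : C -> C) (z : C) : C :=
  (/ 2 * (partial_x f z - Ci * partial_y f z))%C.

Definition D_zbar (f : C -> C) (z : C) : C :=
  (/ 2 * (partial_x f z + Ci * partial_y f z))%C.

(* [Derive] is total, so differentiability has to be required separately.
   On an open set, [ex_diff_n _ 2] at every point means class C^2. *)
Definition C2_on (Omega : C -> Prop) (psi : C -> R) : Prop :=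
  forall z, Omega z -> ex_diff_n (fun x y => psi (x, y)) 2 (Re z) (Im z).

(* Classical real solutions of
   psi_{z zbar} + (1/2) e^psi + |U|^2 e^{-2 psi} = 0 on [Omega]. *)
Definition solution (U : C -> C) (Omega : C -> Prop) (psi : C -> R) : Prop :=
  C2_on Omega psi /\
  forall z, Omega z ->
    (D_zbar (D_z (fun w => RtoC (psi w))) z
     + RtoC (/ 2 * exp (psi z))
     + RtoC ((Cmod (U z)) ^ 2 * exp (- 2 * psi z)))%C = RtoC 0.

Definition rotation (c : R) (z : C) : C := ((cos c, sin c) * z)%C.

Definition rotation_invariant_set (Omega : C -> Prop) : Prop :=
  forall c z, Omega z -> Omega (rotation c z).

Definition rotation_invariant (Omega : C -> Prop) (psi : C -> R) : Prop :=
  forall c z, Omega z -> psi (rotation c z) = psi z.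

(* Twice differentiability is spelled out because [ex_derive_n H 2 s] only says
   that [Derive H] is differentiable at [s], not that [H] is. *)
Definition twice_differentiable_on (I : R -> Prop) (H : R -> R) : Prop :=
  forall s, I s -> ex_derive H s /\ ex_derive (Derive H) s.

Definition painleve_III (alpha beta gamma delta : R)
    (I : R -> Prop) (H : R -> R) : Prop :=
  twice_differentiable_on I H /\
  forall s, I s ->
    s <> 0 /\ H s <> 0 /\
    Derive_n H 2 s =
      (Derive H s) ^ 2 / H s - Derive H s / s
      + (alpha * (H s) ^ 2 + beta) / s
      + gamma * (H s) ^ 3 + delta / H s.

Definition sqrt_moduli (Omega : C -> Prop) (s : R) : Prop :=
  exists z, Omega z /\ s = sqrt (Cmod z).

(* Main.v *)
(** Rotation invariance makes [psi] a function [g] of [r = |z|], so it suffices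
    to work at [z = r > 0].  There [psi_xx = g''(r)], while differentiating
    [psi(r, y) = g(sqrt(r^2 + y^2))] twice at [y = 0] gives
    [psi_yy = g'(r) / r]; as [4 psi_{z zbar} = psi_xx + psi_yy], the equation
    becomes an ODE for [g].  With [H(s) = s^3 exp(g(s^2))] it turns into
    Painleve III, since [ln s] is annihilated by [d^2/ds^2 + (1/s) d/ds]. *)
Require Import Defs.
From Stdlib Require Import Reals Lra.
From Coquelicot Require Import Coquelicot.
Open Scope R_scope.

Lemma polar_angle (x y : R) : x ^ 2 + y ^ 2 = 1 ->
  exists c, cos c = x /\ sin c = y.
Proof.
  intros H.
  assert (Hx : -1 <= x <= 1) by nra.
  assert (Hs : sqrt (1 - x²) = Rabs y).
  { rewrite <- sqrt_Rsqr_abs; f_equal; unfold Rsqr; nra. }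
  destruct (Rle_dec 0 y) as [Hy | Hy].
  - exists (acos x).
    rewrite cos_acos, sin_acos, Hs, Rabs_pos_eq; auto.
  (* [acos] takes values in [0, PI], where the sine is nonnegative; the lower half circle is reached
     by reflecting the angle. *)
  - exists (- acos x).
    rewrite cos_neg, sin_neg, cos_acos, sin_acos, Hs, Rabs_left by lra.
    split; ring.
Qed.

(** The rotation is multiplication by the unit number conj(z) / |z|, whose cosine and sine are
    [x / r] and [- y / r]. Every rotation orbit thus meets the positive axis, so [psi] is determined
    by its values there. *)
Lemma rotate_to_positive_axis (z : C) : z <> RtoC 0 ->
  exists c, rotation c z = RtoC (Cmod z).
Proof.
  intros Hz. apply Cmod_gt_0 in Hz. destruct z as [x y].
  set (r := Cmod (x, y)) in *.
  assert (Hr : r * r = x ^ 2 + y ^ 2)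
    by (apply sqrt_sqrt; simpl; nra).
  destruct (polar_angle (x / r) (- y / r)) as [c [Hc Hs]].
  { replace ((x / r) ^ 2 + (- y / r) ^ 2) with ((x ^ 2 + y ^ 2) / (r * r))
      by (field; lra).
    rewrite <- Hr. field. lra. }
  exists c. unfold rotation. rewrite Hc, Hs.
  unfold Cmult, RtoC; simpl. f_equal.
  - replace (x / r * x - - y / r * y) with ((x ^ 2 + y ^ 2) / r)
      by (field; lra).
    rewrite <- Hr. field. lra.
  - field. lra.
Qed.

(** Rewriting under [Derive] requires an identity on a whole neighbourhood; continuity of the curve
    pulls one back from the open set. The curves used are the horizontal and vertical lines through
    a point of the positive axis, and the real axis parametrized by squares. *)
Lemma locally_curve (Omega : C -> Prop) (x y : R -> R) (t : R) :
  open Omega -> Omega (x t, y t) -> ex_derive x t -> ex_derive y t ->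
  locally t (fun u => Omega (x u, y u)).
Proof.
  intros Ho Ht Hx Hy.
  assert (Hc : continuous (fun u => (x u, y u) : C_UniformSpace) t).
  { apply (continuous_comp_2 x y (fun a b => (a, b) : C_UniformSpace)).
    - exact (ex_derive_continuous (V := R_NormedModule) x t Hx).
    - exact (ex_derive_continuous (V := R_NormedModule) y t Hy).
    - apply continuous_ext with (fun p : C_UniformSpace => p).
      + now intros [a b].
      + apply continuous_id. }
  exact (Hc Omega (Ho _ Ht)).
Qed.

(** The mixed partials enter only the imaginary part, so the real part is a quarter of the
    Laplacian, with no appeal to the symmetry of second derivatives. *)
Lemma Re_D_zbar_D_z_real (psi : C -> R) (x y : R) :
  Re (D_zbar (D_z (fun w => RtoC (psi w))) (x, y)) =
  / 4 * (Derive (Derive (fun t => psi (t, y))) x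
         + Derive (Derive (fun t => psi (x, t))) y).
Proof.
  assert (HD : forall a b, D_z (fun w => RtoC (psi w)) (a, b) =
    (/ 2 * Derive (fun t => psi (t, b)) a,
     - / 2 * Derive (fun t => psi (a, t)) b)).
  { intros a b. unfold D_z, partial_x, partial_y; simpl.
    rewrite !Derive_const.
    unfold Cmult, Cplus, Cminus, Copp, Ci, RtoC; simpl.
    f_equal; simpl; field. }
  set (F := D_z (fun w => RtoC (psi w))) in *.
  assert (Hre : forall p q : C,
            Re (/ 2 * (p + Ci * q))%C = / 2 * (Re p - Im q)).
  { intros [p1 p2] [q1 q2].
    unfold Cmult, Cplus, Ci, RtoC; simpl. field. }
  unfold D_zbar. rewrite Hre.
  change (Re (partial_x F (x, y))) with (Derive (fun t => Re (F (t, y))) x).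
  change (Im (partial_y F (x, y))) with (Derive (fun t => Im (F (x, t))) y).
  rewrite (Derive_ext (fun t => Re (F (t, y)))
             (fun t => / 2 * Derive (fun u => psi (u, y)) t))
    by (intros t; now rewrite HD).
  rewrite (Derive_ext (fun t => Im (F (x, t)))
             (fun t => - / 2 * Derive (fun u => psi (x, u)) t))
    by (intros t; now rewrite HD).
  rewrite !Derive_scal. field.
Qed.

Lemma ex_derive_along_x (psi : C -> R) (x y : R) :
  ex_diff_n (fun u v => psi (u, v)) 2 x y ->
  ex_derive (fun t => psi (t, y)) x /\
  ex_derive (Derive (fun t => psi (t, y))) x.
Proof.
  intros H. simpl in H. tauto.
Qed.

(** With rho = sqrt(r^2 + y^2), the first derivative is (y / rho) g'(rho). The factor y / rho
    vanishes at y = 0 with slope 1/r, so the product rule kills the g'' term and leaves g'(r) /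
    r. *)
Lemma Derive2_transverse_radial (g : R -> R) (r : R) :
  0 < r -> locally r (ex_derive g) -> ex_derive (Derive g) r ->
  Derive (Derive (fun y => g (sqrt (r ^ 2 + y ^ 2)))) 0 = Derive g r / r.
Proof.
  intros Hr Hloc Hg.
  assert (Hpos : forall y, 0 < r ^ 2 + y ^ 2) by (intros y; nra).
  assert (Hs : forall y, is_derive (fun y => sqrt (r ^ 2 + y ^ 2)) y
                 (y / sqrt (r ^ 2 + y ^ 2))).
  { intros y. specialize (Hpos y).
    assert (0 < sqrt (r ^ 2 + y ^ 2)) by now apply sqrt_lt_R0.
    auto_derive; [simpl in *; lra |].
    replace (r * (r * 1) + y * (y * 1)) with (r ^ 2 + y ^ 2) by ring.
    field; lra. }
  assert (H0 : sqrt (r ^ 2 + 0 ^ 2) = r).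
  { replace (r ^ 2 + 0 ^ 2) with (r²) by (unfold Rsqr; ring).
    apply sqrt_Rsqr; lra. }
  rewrite (Derive_ext_loc _ (fun y => y / sqrt (r ^ 2 + y ^ 2)
                                      * Derive g (sqrt (r ^ 2 + y ^ 2)))).
  - assert (Hc : ex_derive (fun y => Derive g (sqrt (r ^ 2 + y ^ 2))) 0).
    { apply (ex_derive_comp (Derive g)).
      - now rewrite H0.
      - eexists; apply Hs. }
    assert (Hq : is_derive (fun y => y / sqrt (r ^ 2 + y ^ 2)) 0 (/ r)).
    { auto_derive.
      - replace (r * (r * 1) + 0 * (0 * 1)) with (r ^ 2 + 0 ^ 2) by ring.
        rewrite H0. split; [apply Hpos | lra].
      - replace (r * (r * 1) + 0 * (0 * 1)) with (r ^ 2 + 0 ^ 2) by ring.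
        rewrite H0. field. lra. }
    rewrite Derive_mult; [| now exists (/ r) | exact Hc].
    replace (Derive (fun y => y / sqrt (r ^ 2 + y ^ 2)) 0) with (/ r)
      by (symmetry; now apply is_derive_unique).
    rewrite H0. field. lra.
  - assert (Hcont : continuous (fun y => sqrt (r ^ 2 + y ^ 2)) 0)
      by (apply (ex_derive_continuous (V := R_NormedModule));
          eexists; apply Hs).
    (* The radius is continuous in [y] and equals [r] at 0, so for small [y] it stays where [g] is
       differentiable and the chain rule applies. *)
    unfold continuous in Hcont. rewrite H0 in Hcont.
    generalize (Hcont _ Hloc). unfold filtermap. apply filter_imp.
    intros y Hy. apply is_derive_unique.
    apply (is_derive_comp g); [now apply Derive_correct | apply Hs].
Qed.

Section Radial.

Context (Omega : C -> Prop) (psi : C -> R)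
  (Omega_open : open Omega)
  (Omega_ne0 : forall z : C, Omega z -> z <> RtoC 0)
  (Omega_rot : rotation_invariant_set Omega)
  (psi_rot : rotation_invariant Omega psi).

Lemma radial_domain (z : C) : Omega z -> Omega (RtoC (Cmod z)).
Proof.
  intros Hz.
  destruct (rotate_to_positive_axis z (Omega_ne0 z Hz)) as [c <-].
  now apply Omega_rot.
Qed.

Lemma radial_value (z : C) : Omega z -> psi z = psi (RtoC (Cmod z)).
Proof.
  intros Hz.
  destruct (rotate_to_positive_axis z (Omega_ne0 z Hz)) as [c <-].
  symmetry. now apply psi_rot.
Qed.

Lemma radial_equation (r : R) :
  0 < r -> Omega (RtoC r) ->
  solution (fun z : C => (/ (z ^ 2))%C) Omega psi ->
  let g := fun t => psi (RtoC t) in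
  / 4 * (Derive (Derive g) r + Derive g r / r)
  + / 2 * exp (g r) + / (r ^ 4) * / (exp (g r) ^ 2) = 0.
Proof.
  intros Hr HO [HC2 Heq] g.
  assert (Hloc : locally r (ex_derive g)).
  { assert (H := locally_curve Omega (fun t => t) (fun _ => 0) r Omega_open
                   HO (ex_derive_id r) (ex_derive_const 0 r)).
    revert H. apply filter_imp. intros t Ht.
    apply (ex_derive_along_x psi t 0), (HC2 _ Ht). }
  assert (Hg : ex_derive (Derive g) r)
    by apply (ex_derive_along_x psi r 0), (HC2 _ HO).
  specialize (Heq _ HO). apply (f_equal Re) in Heq.
  (* This occurrence is the evaluation point, which becomes the pair [(r, 0)] expected by
     [Re_D_zbar_D_z_real]. *)
  unfold RtoC at 2 in Heq.
  rewrite !re_plus, Re_D_zbar_D_z_real, !re_RtoC in Heq.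
  change (fun t => psi (t, 0)) with g in Heq.
  rewrite Cmod_inv, Cmod_pow, Cmod_R, Rabs_pos_eq in Heq; [| lra |].
  2: { intros H0. apply (f_equal Cmod) in H0.
       rewrite Cmod_pow, Cmod_R, Cmod_0, Rabs_pos_eq in H0 by lra.
       assert (0 < r ^ 2) by (apply pow_lt; lra). lra. }
  rewrite <- (Derive2_transverse_radial g r Hr Hloc Hg).
  rewrite (Derive_ext_loc (Derive (fun y => g (sqrt (r ^ 2 + y ^ 2))))
             (Derive (fun t => psi (r, t)))).
  - replace (exp (-2 * psi (RtoC r))) with (/ exp (g r) ^ 2) in Heq.
    2: { replace (-2 * psi (RtoC r)) with (- (g r + g r)) by (unfold g; ring).
         rewrite exp_Ropp, exp_plus. f_equal. ring. }
    replace ((/ r ^ 2) ^ 2) with (/ r ^ 4) in Heq by (field; lra).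
    exact Heq.
  - assert (H := locally_curve Omega (fun _ => r) (fun t => t) 0 Omega_open
                   HO (ex_derive_const r 0) (ex_derive_id 0)).
    (* For second derivatives to agree at 0, the first ones must agree near 0, so psi(r, t) =
       g(sqrt(r^2 + t^2)) is needed around each nearby point. *)
    apply locally_locally in H.
    revert H. apply filter_imp. intros y Hy.
    apply Derive_ext_loc. revert Hy. apply filter_imp. intros t Ht.
    now rewrite (radial_value _ Ht).
Qed.

End Radial.

(** Both derivatives keep the factor [exp (g (s ^ 2))] with a polynomial cofactor in [s], [g1],
    [g2], which reduces the Painlevé equation to rational algebra. *)
Lemma Derive2_cube_exp_comp_square (g : R -> R) (s : R) :
  locally s (fun t => ex_derive g (t ^ 2)) -> ex_derive (Derive g) (s ^ 2) ->
  let H := fun t => t ^ 3 * exp (g (t ^ 2)) in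
  let g1 := Derive g (s ^ 2) in
  let g2 := Derive (Derive g) (s ^ 2) in
  is_derive H s ((3 * s ^ 2 + 2 * s ^ 4 * g1) * exp (g (s ^ 2))) /\
  is_derive (Derive H) s
    ((6 * s + 14 * s ^ 3 * g1 + 4 * s ^ 5 * g1 ^ 2 + 4 * s ^ 5 * g2)
     * exp (g (s ^ 2))).
Proof.
  intros Hloc Hg2 H g1 g2.
  assert (H1 : forall t, ex_derive g (t ^ 2) -> is_derive H t
            ((3 * t ^ 2 + 2 * t ^ 4 * Derive g (t ^ 2)) * exp (g (t ^ 2)))).
  { intros t Ht. unfold H. auto_derive; [exact Ht |]. simpl.
    change (fun x => g x) with g. ring. }
  assert (Hs := locally_singleton _ _ Hloc).
  split; [now apply H1 |].
  apply is_derive_ext_loc with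
    (fun t => (3 * t ^ 2 + 2 * t ^ 4 * Derive g (t ^ 2)) * exp (g (t ^ 2))).
  - revert Hloc. apply filter_imp. intros t Ht.
    symmetry. now apply is_derive_unique, H1.
  - auto_derive.
    + repeat split; [exact Hg2 | exact Hs].
    + change (fun x => g x) with g.
      change (fun x => Derive g x) with (Derive g).
      unfold g1, g2. simpl. ring.
Qed.

Theorem proposition1p3 (Omega : C -> Prop) (psi : C -> R)
  (Omega_open : open Omega)
  (Omega_ne0 : forall z : C, Omega z -> z <> RtoC 0)
  (Omega_rot : rotation_invariant_set Omega)
  (psi_sol : solution (fun z : C => (/ (z ^ 2))%C) Omega psi)
  (psi_rot : rotation_invariant Omega psi) :
  exists H : R -> R,
    (forall z : C, Omega z ->
       let s := sqrt (Cmod z) in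
       0 < H s /\ psi z = ln (H s) - 3 * ln s) /\
    twice_differentiable_on (sqrt_moduli Omega) H /\
    (forall s : R, sqrt_moduli Omega s ->
       Derive_n H 2 s =
         (Derive H s) ^ 2 / H s - Derive H s / s
         - 8 * (H s) ^ 2 / s - 16 / H s) /\
    painleve_III (-8) 0 0 (-16) (sqrt_moduli Omega) H.
Proof.
  set (g := fun t : R => psi (RtoC t)).
  set (H := fun s : R => s ^ 3 * exp (g (s ^ 2))).
  assert (Hdom : forall s, sqrt_moduli Omega s ->
            0 < s /\ Omega (RtoC (s ^ 2))).
  { intros s [z [Hz ->]].
    assert (0 < Cmod z) by now apply Cmod_gt_0, Omega_ne0.
    rewrite pow2_sqrt by lra.
    split; [now apply sqrt_lt_R0 | now apply radial_domain]. }
  assert (HD : forall s, sqrt_moduli Omega s ->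
            locally s (fun t => ex_derive g (t ^ 2)) /\
            ex_derive (Derive g) (s ^ 2)).
  { intros s Hs. apply Hdom in Hs as [_ HO].
    destruct psi_sol as [HC2 _]. split.
    - assert (Hsq : ex_derive (fun t => t ^ 2) s) by (auto_derive; trivial).
      generalize (locally_curve Omega (fun t => t ^ 2) (fun _ => 0) s
                    Omega_open HO Hsq (ex_derive_const 0 s)).
      apply filter_imp. intros t Ht.
      apply (ex_derive_along_x psi (t ^ 2) 0), (HC2 _ Ht).
    - apply (ex_derive_along_x psi (s ^ 2) 0), (HC2 _ HO). }
  assert (Htwice : twice_differentiable_on (sqrt_moduli Omega) H).
  { intros s Hs. destruct (HD s Hs) as [H1 H2].
    destruct (Derive2_cube_exp_comp_square g s H1 H2) as [D1 D2].
    split; eexists; [exact D1 | exact D2]. }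
  assert (Hpos : forall s, sqrt_moduli Omega s -> 0 < H s).
  { intros s Hs. apply Rmult_lt_0_compat; [| apply exp_pos].
    now apply pow_lt, Hdom. }
  assert (HP : forall s, sqrt_moduli Omega s ->
       Derive_n H 2 s =
         (Derive H s) ^ 2 / H s - Derive H s / s
         - 8 * (H s) ^ 2 / s - 16 / H s).
  { intros s Hs. destruct (HD s Hs) as [H1 H2].
    destruct (Hdom s Hs) as [Hs0 HO].
    destruct (Derive2_cube_exp_comp_square g s H1 H2) as [D1 D2].
    fold H in D1, D2.
    change (Derive_n H 2 s) with (Derive (Derive H) s).
    rewrite (is_derive_unique _ _ _ D1), (is_derive_unique _ _ _ D2).
    unfold H.
    assert (E := radial_equation Omega psi Omega_open Omega_ne0
                   psi_rot (s ^ 2) (pow_lt s 2 Hs0) HO psi_sol).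
    cbv zeta in E. fold g in E.
    change (psi (RtoC (s ^ 2))) with (g (s ^ 2)) in E.
    set (e := exp (g (s ^ 2))) in *.
    assert (He : 0 < e) by apply exp_pos.
    set (g1 := Derive g (s ^ 2)) in *.
    set (g2 := Derive (Derive g) (s ^ 2)) in *.
    (* Four times the radial equation at r = s^2, solved for g''. *)
    assert (E2 : g2 = - g1 / s ^ 2 - 2 * e - 4 / (s ^ 8 * e ^ 2)).
    { apply Rminus_diag_uniq. rewrite <- (Rmult_0_r 4), <- E.
      field. split; lra. }
    (* Here H = s^3 e. The terms free of the nonlinearities, (6 s + 10 s^3 g1 + 4 s^5 g1^2) e, equal
       H'^2 / H - H' / s. The rest of 4 s^5 g2 e is -8 s^5 e^2 = -8 H^2 / s and -16 / (s^3 e) = -16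
       / H. *)
    rewrite E2. field. split; lra. }
  exists H. split; [| split; [exact Htwice | split; [exact HP |]]].
  - intros z Hz s.
    assert (Hs : sqrt_moduli Omega s) by now exists z.
    destruct (Hdom s Hs) as [Hs0 _].
    split; [now apply Hpos |].
    unfold H. rewrite ln_mult, ln_exp, ln_pow;
      [| lra | now apply pow_lt | apply exp_pos].
    (* Only the argument s^2 of [g] is turned into |z|; the two [ln s] terms stay as they are and
       cancel. *)
    unfold s at 2. rewrite pow2_sqrt by apply Cmod_ge_0.
    rewrite (radial_value Omega psi Omega_ne0 psi_rot z Hz).
    unfold g. simpl INR. ring.
  - split; [exact Htwice |]. intros s Hs.
    destruct (Hdom s Hs) as [Hs0 _]. assert (Hh := Hpos s Hs).
    split; [lra | split; [lra |]].
    rewrite (HP s Hs). field. split; lra.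
Qed.
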